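(* Let $\ell$ be an odd prime and fix integers $p,q,g\ge0$, $e\ge1$, $r\geq 1$ with $e+g=r$; set $t:=p+q+r-1$ and assume $t\ge2$. Let $\mathrm{Prob}_\ell(\mu=0,\lambda=1)$ be the probability that $\mu_\alpha=0$ and $\lambda_\alpha=1$ for the datum $X_{p,q,r}^{e,g}$. Then the following assertions hold. \begin{enumerate} \item Suppose that $\ell\mid r$. Then $$\mathrm{Prob}_\ell(\mu=0,\lambda=1)=1-(1-\ell^{-t})^{-1}\big(\ell^{-1}-\ell^{-t}\big).$$ \item Suppose that $\ell\nmid r$. Then there is a number $\upsilon\in\{+1,-1\}$ for which $$\mathrm{Prob}_\ell(\mu=0,\lambda=1)=\begin{cases}1-(1-\ell^{-t})^{-1}\big(\ell^{-1}-\ell^{-t}\big)&\text{if }t\text{ is odd},\\ 1-(1-\ell^{-t})^{-1}\big(\ell^{-1}+\upsilon(\ell-1)\ell^{-(t/2+1)}-\ell^{-t}\big)&\text{if }t\text{ is even}.\end{cases}$$ \end{enumerate}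
   Context: For $b\in\mathbb{Z}_\ell$ put $\binom{b}{n}=\frac{b(b-1)\cdots(b-n+1)}{n!}\in\mathbb{Z}_\ell$ and $(1+T)^b=\sum_{n\ge0}\binom{b}{n}T^n\in\mathbb{Z}_\ell[[T]]$. $X_{p,q,r}^{e,g}$ denotes the multigraph with two vertices $v_1,v_2$, with $p$ undirected loops at $v_1$, $q$ undirected loops at $v_2$ and $r$ undirected edges joining $v_1$ and $v_2$, together with a choice of orientation $S$ of the edges (one directed edge for each undirected edge) in which $e$ of the $r$ edges are directed from $v_1$ to $v_2$ and $g=r-e$ from $v_2$ to $v_1$. A voltage vector is $\alpha=(a_1,\dots,a_p,b_1,\dots,b_e,c_1,\dots,c_g,d_1,\dots,d_q)$ with entries in $\mathbb{Z}_\ell$, where $a_i$ are the values on the loops at $v_1$, $b_i$ on the edges directed from $v_1$ to $v_2$, $c_i$ on the edges directed from $v_2$ to $v_1$, and $d_i$ on the loops at $v_2$. The vector $\alpha$ is admissible if $b_1=0$ and at least one coordinate of $\alpha$ is in $\mathbb{Z}_\ell^\times$. Admissible vectors are identified with the vectors $\alpha_0=(a_1,\dots,a_p,b_2,\dots,b_e,c_1,\dots,c_g,d_1,\dots,d_q)\in\mathbb{Z}_\ell^t\setminus(\ell\mathbb{Z}_\ell)^t$ obtained by dropping $b_1$. The characteristic series is $f(T)=\det\begin{pmatrix} m_{1,1} & m_{1,2} \\ m_{2,1} & m_{2,2} \end{pmatrix}\in\mathbb{Z}_\ell[[T]]$, where $m_{1,1}=r+\sum_{i=1}^p(2-(1+T)^{a_i}-(1+T)^{-a_i})$,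 $m_{1,2}=-\big(\sum_{i=1}^e(1+T)^{b_i}+\sum_{j=1}^g(1+T)^{-c_j}\big)$, $m_{2,1}=-\big(\sum_{i=1}^e(1+T)^{-b_i}+\sum_{j=1}^g(1+T)^{c_j}\big)$, $m_{2,2}=r+\sum_{i=1}^q(2-(1+T)^{d_i}-(1+T)^{-d_i})$. For admissible $\alpha$ it is nonzero, and its constant term is $0$. By Weierstrass preparation write $f(T)=\ell^\mu h(T)u(T)$ with $\mu\in\mathbb{Z}_{\geq 0}$, $h$ a distinguished polynomial (monic, all non-leading coefficients divisible by $\ell$) and $u\in\mathbb{Z}_\ell[[T]]^\times$; then $\mu_\alpha:=\mu$ and $\lambda_\alpha:=\deg h-1$ (note the shift by $-1$). Let $\tau$ be the Haar measure on $\mathbb{Z}_\ell^t$ with $\tau(\mathbb{Z}_\ell^t)=1$. Define $\mathrm{Prob}_\ell(\mu=0,\lambda=1)=(1-\ell^{-t})^{-1}\tau\big(\{\alpha_0\in\mathbb{Z}_\ell^t\setminus(\ell\mathbb{Z}_\ell)^t:\mu_\alpha=0,\ \lambda_\alpha=1\}\big)$. *)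

(* Defs.v *)
From HB Require Import structures.
From mathcomp Require Import all_boot all_order all_algebra.
From mathcomp Require Import all_classical all_reals all_analysis.

Set Implicit Arguments.
Unset Strict Implicit.
Unset Printing Implicit Defensive.

Import Order.TTheory GRing.Theory Num.Theory.

Local Open Scope classical_set_scope.
Local Open Scope ring_scope.

Section ClassicalUnits.
Variable R : comNzRingType.

Definition cunit : {pred R} := fun x => `[< exists y : R, y * x = 1 >].
Definition cinv (x : R) : R := xget x [set y | y * x = 1].

Lemma cmulVx : {in cunit, left_inverse 1 cinv *%R}.
Proof.
move=> x /asboolP[y yx1]; rewrite /cinv.
by apply: (@xgetPex _ x [set y | y * x = 1]); exists y.
Qed.

Lemma cunitPl (x y : R) : y * x = 1 -> cunit x.
Proof. by move=> yx1; apply/asboolP; exists y. Qed.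

Lemma cinv_out : {in [predC cunit], cinv =1 id}.
Proof.
move=> x; rewrite inE /cinv => /asboolP xNU.
by case: xgetP => // y _ yx1; case: xNU; exists y.
Qed.

End ClassicalUnits.

(* l-adic integers, as the inverse limit of the rings Z / l^(n+1), n >= 0.    *)
(* The exponent starts at 1 because 'Z_1 denotes Z / 2 in MathComp.           *)
Record padic_int (l : nat) := PadicInt {
  pres :> forall n, 'Z_(l ^ n.+1);
  pres_compat : forall n, inZp (pres n.+1) = pres n }.

Section PadicInt.
Variable l : nat.
Local Notation Zl := (padic_int l).
Local Notation md n := (Zp_trunc (l ^ n.+1)).+2.
Implicit Types x y z : Zl.

Lemma padicP x y : (forall n, x n = y n) -> x = y.
Proof.
case: x y => [x xP] [y yP] /= xy.
have e : x = y by apply: functional_extensionality_dep.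
by case: _ / e yP => yP; congr PadicInt; apply: Prop_irrelevance.
Qed.

HB.instance Definition _ := gen_eqMixin Zl.
HB.instance Definition _ := gen_choiceMixin Zl.

Lemma dvdn_md n : (md n %| md n.+1)%N.
Proof.
case: (@ltnP 1 l) => [l_gt1|].
  rewrite !Zp_cast ?dvdn_exp2l //; last exact: (@ltn_exp2l l 0).
  exact: (@ltn_exp2l l 0).
by case: l => [|[|k]] // _; rewrite ?exp1n ?exp0n.
Qed.

Lemma inZp_md n (k : nat) : inZp (inZp k : 'I_(md n.+1)) = inZp k :> 'I_(md n).
Proof. by apply: val_inj; rewrite /= modn_dvdm ?dvdn_md. Qed.

Lemma inZpD p (i j : nat) : inZp (i + j) = inZp i + inZp j :> 'I_p.+1.
Proof. by apply: val_inj; rewrite /= modnDm. Qed.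

Lemma inZpM p (i j : nat) : inZp (i * j) = inZp i * inZp j :> 'I_p.+2.
Proof. by apply: val_inj; rewrite /= modnMm. Qed.

Lemma redD n (a b : 'I_(md n.+1)) :
  inZp (a + b)%R = inZp a + inZp b :> 'I_(md n).
Proof. by rewrite -{1}[a]valZpK -{1}[b]valZpK -inZpD inZp_md inZpD. Qed.

Lemma redM n (a b : 'I_(md n.+1)) :
  inZp (a * b)%R = inZp a * inZp b :> 'I_(md n).
Proof. by rewrite -{1}[a]valZpK -{1}[b]valZpK -inZpM inZp_md inZpM. Qed.

Lemma red0 n : inZp (0%R : 'I_(md n.+1)) = 0 :> 'I_(md n).
Proof. by apply: val_inj; rewrite /= mod0n. Qed.

Lemma red1 n : inZp (1%R : 'I_(md n.+1)) = 1 :> 'I_(md n).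
Proof. exact: inZp_md. Qed.

Lemma redN n (a : 'I_(md n.+1)) : inZp (- a)%R = - inZp a :> 'I_(md n).
Proof. by apply/eqP; rewrite -addr_eq0 -redD addNr red0. Qed.

Definition padic0 : Zl := PadicInt (fun n => red0 n).
Definition padic1 : Zl := PadicInt (fun n => red1 n).

Lemma padic_opp_compat x n : inZp (- x n.+1)%R = - x n.
Proof. by rewrite redN pres_compat. Qed.
Definition padic_opp x : Zl := PadicInt (padic_opp_compat x).

Lemma padic_add_compat x y n : inZp (x n.+1 + y n.+1)%R = x n + y n.
Proof. by rewrite redD !pres_compat. Qed.
Definition padic_add x y : Zl := PadicInt (padic_add_compat x y).

Lemma padic_mul_compat x y n : inZp (x n.+1 * y n.+1)%R = x n * y n.
Proof. by rewrite redM !pres_compat. Qed.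
Definition padic_mul x y : Zl := PadicInt (padic_mul_compat x y).

Lemma padic_addA : associative padic_add.
Proof. by move=> x y z; apply: padicP => n /=; rewrite addrA. Qed.
Lemma padic_addC : commutative padic_add.
Proof. by move=> x y; apply: padicP => n /=; rewrite addrC. Qed.
Lemma padic_add0 : left_id padic0 padic_add.
Proof. by move=> x; apply: padicP => n /=; rewrite add0r. Qed.
Lemma padic_addN : left_inverse padic0 padic_opp padic_add.
Proof. by move=> x; apply: padicP => n /=; rewrite addNr. Qed.

HB.instance Definition _ := GRing.isZmodule.Build Zl
  padic_addA padic_addC padic_add0 padic_addN.

Lemma padic_mulA : associative padic_mul.
Proof. by move=> x y z; apply: padicP => n /=; rewrite mulrA. Qed.
Lemma padic_mulC : commutative padic_mul.
Proof. by move=> x y; apply: padicP => n /=; rewrite mulrC. Qed.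
Lemma padic_mul1 : left_id padic1 padic_mul.
Proof. by move=> x; apply: padicP => n /=; rewrite mul1r. Qed.
Lemma padic_mulDl : left_distributive padic_mul padic_add.
Proof. by move=> x y z; apply: padicP => n /=; rewrite mulrDl. Qed.
Lemma padic1_neq0 : padic1 != padic0.
Proof. by apply/eqP => /(congr1 (fun x : Zl => x 0%N : nat)). Qed.

HB.instance Definition _ := GRing.Zmodule_isComNzRing.Build Zl
  padic_mulA padic_mulC padic_mul1 padic_mulDl padic1_neq0.
HB.instance Definition _ := GRing.ComNzRing_hasMulInverse.Build Zl
  (@cmulVx Zl) (@cunitPl Zl) (@cinv_out Zl).

(* l-adic topology: the classes modulo l^(n+1) form a basis of neighborhoods. *)
Definition padic_nbhs x : set_system Zl :=
  filter_from [set: nat] (fun n => [set y : Zl | y n = x n]).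

HB.instance Definition _ := hasNbhs.Build Zl padic_nbhs.
HB.instance Definition _ := isPointed.Build Zl 0.

Lemma padic_res_le x y (m n : nat) : (m <= n)%N -> x n = y n -> x m = y m.
Proof.
elim: n => [|n IHn]; first by rewrite leqn0 => /eqP ->.
rewrite leq_eqVlt => /predU1P[-> //|mn xy]; apply: IHn => //.
by rewrite -(pres_compat x) -(pres_compat y) xy.
Qed.

Lemma padic_nbhs_filter x : ProperFilter (nbhs x).
Proof.
apply: filter_from_proper; last by move=> n _; exists x.
apply: filter_from_filter; first by exists 0%N.
move=> m n _ _; exists (maxn m n) => // y yx.
split; apply: padic_res_le yx; [exact: leq_maxl | exact: leq_maxr].
Qed.

Lemma padic_nbhs_singleton x (A : set Zl) : nbhs x A -> A x.
Proof. by case=> n _; apply. Qed.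

Lemma padic_nbhs_nbhs x (A : set Zl) : nbhs x A -> nbhs x (nbhs^~ A).
Proof.
case=> n _ nA; exists n => // y yx; exists n => // z zy.
by apply: nA; rewrite /= zy.
Qed.

HB.instance Definition _ := Nbhs_isNbhsTopological.Build Zl
  padic_nbhs_filter padic_nbhs_singleton padic_nbhs_nbhs.

End PadicInt.

Record pseries (R : comNzRingType) := PSeries { pscoef : nat -> R }.

Section PowerSeries.
Variable R : comNzRingType.
Local Notation RT := (pseries R).
Implicit Types f g h : RT.

Lemma pseriesP f g : (forall n, pscoef f n = pscoef g n) -> f = g.
Proof. by case: f g => [f] [g] /= fg; congr PSeries; apply: funext. Qed.

HB.instance Definition _ := gen_eqMixin RT.
HB.instance Definition _ := gen_choiceMixin RT.

Definition ps0 : RT := PSeries (fun=> 0).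
Definition ps1 : RT := PSeries (fun n => (n == 0%N)%:R).
Definition ps_opp f : RT := PSeries (fun n => - pscoef f n).
Definition ps_add f g : RT := PSeries (fun n => pscoef f n + pscoef g n).
Definition ps_mul f g : RT :=
  PSeries (fun n => \sum_(i < n.+1) pscoef f i * pscoef g (n - i)%N).

Lemma ps_addA : associative ps_add.
Proof. by move=> f g h; apply: pseriesP => n /=; rewrite addrA. Qed.
Lemma ps_addC : commutative ps_add.
Proof. by move=> f g; apply: pseriesP => n /=; rewrite addrC. Qed.
Lemma ps_add0 : left_id ps0 ps_add.
Proof. by move=> f; apply: pseriesP => n /=; rewrite add0r. Qed.
Lemma ps_addN : left_inverse ps0 ps_opp ps_add.
Proof. by move=> f; apply: pseriesP => n /=; rewrite addNr. Qed.

HB.instance Definition _ := GRing.isZmodule.Build RT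
  ps_addA ps_addC ps_add0 ps_addN.

Definition ps_trunc n f : {poly R} := \poly_(i < n.+1) pscoef f i.

Lemma coef_ps_trunc n f k : (k <= n)%N -> (ps_trunc n f)`_k = pscoef f k.
Proof. by move=> kn; rewrite coef_poly ltnS kn. Qed.

Lemma ps_mul_trunc n f g k : (k <= n)%N ->
  pscoef (ps_mul f g) k = (ps_trunc n f * ps_trunc n g)`_k.
Proof.
move=> kn; rewrite coefM; apply: eq_bigr => i _.
rewrite !coef_ps_trunc ?(leq_trans (leq_subr _ _)) //.
by rewrite (leq_trans _ kn) // -ltnS.
Qed.

Lemma ps_mulC : commutative ps_mul.
Proof.
by move=> f g; apply: pseriesP => n; rewrite !(@ps_mul_trunc n) // mulrC.
Qed.

Lemma ps_mulA : associative ps_mul.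
Proof.
move=> f g h; apply: pseriesP => n.
transitivity ((ps_trunc n f * (ps_trunc n g * ps_trunc n h))`_n).
  rewrite coefM; apply: eq_bigr => i _.
  by rewrite -ps_mul_trunc ?leq_subr // coef_ps_trunc // -ltnS.
rewrite mulrA coefM; apply: eq_bigr => i _.
by rewrite -ps_mul_trunc ?coef_ps_trunc ?leq_subr // -ltnS.
Qed.

Lemma ps_mul1 : left_id ps1 ps_mul.
Proof.
move=> f; apply: pseriesP => n /=; rewrite big_ord_recl subn0 mul1r.
by rewrite big1 ?addr0 // => i _; rewrite mul0r.
Qed.

Lemma ps_mulDl : left_distributive ps_mul ps_add.
Proof.
move=> f g h; apply: pseriesP => n /=; rewrite -big_split /=.
by apply: eq_bigr => i _; rewrite mulrDl.
Qed.

Lemma ps1_neq0 : ps1 != ps0.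
Proof.
apply/eqP => /(congr1 (fun f : RT => pscoef f 0)) /= /eqP.
by rewrite oner_eq0.
Qed.

HB.instance Definition _ := GRing.Zmodule_isComNzRing.Build RT
  ps_mulA ps_mulC ps_mul1 ps_mulDl ps1_neq0.
HB.instance Definition _ := GRing.ComNzRing_hasMulInverse.Build RT
  (@cmulVx RT) (@cunitPl RT) (@cinv_out RT).

Definition ps_of_poly (p : {poly R}) : RT := PSeries (fun n => p`_n).

End PowerSeries.

Section Iwasawa.
Variable l : nat.
Local Notation Zl := (padic_int l).

(* b(b-1)...(b-n+1) / n!, i.e. the c with n! c = b(b-1)...(b-n+1). For l      *)
(* prime, c exists for every b in Zl (although n! need not be a unit), and is *)
(* unique because Zl is torsion-free; the default 0 is then not used.         *)
Definition padic_binom (b : Zl) (n : nat) : Zl :=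
  xget 0 [set c | (n`!)%:R * c = \prod_(i < n) (b - i%:R)].

(* (1 + T)^b *)
Definition onepT (b : Zl) : pseries Zl := PSeries (padic_binom b).

Definition lideal : set Zl := [set x | exists c, x = l%:R * c].

Definition distinguished (h : {poly Zl}) : Prop :=
  h \is monic /\ forall i, (i < (size h).-1)%N -> lideal h`_i.

Definition weierstrass (f : pseries Zl)
    (w : nat * {poly Zl} * pseries Zl) : Prop :=
  let: (mu, h, u) := w in
  [/\ distinguished h, u \is a GRing.unit & f = l%:R ^+ mu * ps_of_poly h * u].

(* By Weierstrass preparation a decomposition exists and is unique as soon as *)
(* f != 0 and l is prime; the default value is then not used.                 *)
Definition weierstrass_dec (f : pseries Zl) : nat * {poly Zl} * pseries Zl :=
  xget (0%N, 0, 0) (weierstrass f).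

Definition mu_inv (f : pseries Zl) : nat := (weierstrass_dec f).1.1.

Definition lambda_inv (f : pseries Zl) : int :=
  (size (weierstrass_dec f).1.2).-1%:Z - 1.

(* Voltage vectors of X_{p,q,r}^{e,g}, r = e + g. *)
Record voltage (p q e g : nat) := Voltage {
  va : 'I_p -> Zl;   (* loops at v1 *)
  vb : 'I_e -> Zl;   (* edges from v1 to v2 *)
  vc : 'I_g -> Zl;   (* edges from v2 to v1 *)
  vd : 'I_q -> Zl    (* loops at v2 *) }.

Section CharacteristicSeries.
Variables (p q e g : nat) (alpha : voltage p q e g).

Definition loop_term (x : Zl) : pseries Zl := 2%:R - onepT x - onepT (- x).

Definition m11 : pseries Zl :=
  (e + g)%:R + \sum_(i < p) loop_term (va alpha i).
Definition m12 : pseries Zl :=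
  - (\sum_(i < e) onepT (vb alpha i) + \sum_(j < g) onepT (- vc alpha j)).
Definition m21 : pseries Zl :=
  - (\sum_(i < e) onepT (- vb alpha i) + \sum_(j < g) onepT (vc alpha j)).
Definition m22 : pseries Zl :=
  (e + g)%:R + \sum_(i < q) loop_term (vd alpha i).

Definition char_mx : 'M[pseries Zl]_2 :=
  \matrix_(i < 2, j < 2)
    if i == 0 then (if j == 0 then m11 else m12)
    else (if j == 0 then m21 else m22).

Definition char_series : pseries Zl := \det char_mx.

End CharacteristicSeries.

(* The k-th coordinate (from 0); out of range, it is 0. *)
Definition coord t (a0 : 'rV[Zl]_t) (k : nat) : Zl :=
  if insub k is Some i then a0 0 i else 0.

(* The voltage vector with b_1 = 0 that gives alpha_0 when b_1 is dropped:    *)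
(* alpha_0 = (a_1..a_p, b_2..b_e, c_1..c_g, d_1..d_q), in this order. It is   *)
(* meant for e >= 1 and t = p + (e - 1) + g + q.                              *)
Definition voltage_of p q e g t (a0 : 'rV[Zl]_t) : voltage p q e g :=
  Voltage
    (fun i : 'I_p => coord a0 i)
    (fun i : 'I_e => if i == 0%N :> nat then 0 else coord a0 (p + i.-1))
    (fun i : 'I_g => coord a0 (p + e.-1 + i))
    (fun i : 'I_q => coord a0 (p + e.-1 + g + i)).

Definition admissible t : set 'rV[Zl]_t :=
  ~` [set a0 | forall i, lideal (a0 0 i)].

Definition mu_of p q e g t (a0 : 'rV[Zl]_t) : nat :=
  mu_inv (char_series (voltage_of p q e g a0)).
Definition lambda_of p q e g t (a0 : 'rV[Zl]_t) : int :=
  lambda_inv (char_series (voltage_of p q e g a0)).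

End Iwasawa.

(* Zl^t with the Borel sigma-algebra of its product topology. *)
Definition padic_space (l t : nat) :=
  g_sigma_algebraType (@open 'rV[padic_int l]_t).

(* A Borel probability measure on Zl^t is the normalized Haar measure iff it  *)
(* is invariant under translations.                                           *)
Definition normalized_haar l t (R : realType)
    (tau : probability (padic_space l t) R) : Prop :=
  forall (x : 'rV[padic_int l]_t) (A : set 'rV[padic_int l]_t),
    measurable (A : set (padic_space l t)) ->
    tau [set x + y | y in A] = tau A.

Definition Prob_mu0_lambda1 l p q e g t (R : realType)
    (tau : probability (padic_space l t) R) : R :=
  (1 - l%:R ^- t)^-1 *
  fine (tau [set a0 : 'rV[padic_int l]_t | [/\ admissible a0,
    mu_of p q e g a0 = 0%N & lambda_of p q e g a0 = 1]]).

(* Main.v *)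
Require Import Defs.
From HB Require Import structures.
From mathcomp Require Import all_boot all_order all_algebra.
From mathcomp Require Import all_classical all_reals all_analysis.
From mathcomp Require Import ring zify.

Set Implicit Arguments.
Unset Strict Implicit.
Unset Printing Implicit Defensive.

Import Order.TTheory GRing.Theory Num.Theory.

Local Open Scope ring_scope.

(* The coefficients of [1] and [T] in the characteristic series vanish, and the
   coefficient of [T^2] is [- Q(alpha_0)], where [Q(x) = r (x . x) - (v . x)^2] and [v]
   has entries [1] on the edges from [v_1] to [v_2], [-1] on the edges from [v_2] to
   [v_1] and [0] on the loops. Hence [mu = 0] and [lambda = 1] if and only if [Q] does
   not vanish modulo [l], and since the classes modulo [l] have equal Haar measure it
   remains to count the zeros of [Q] over [F_l]. As [r = 1 + v . v], for [l | r] they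
   form a hyperplane. For [r <> 0] in [F_l], dividing [F_l^(t+1)] by the line spanned
   by [(1, v)] shows that the orthogonal sum of [Q] and [s^2] is equivalent to
   [r (z . z)] in [t + 1] variables. Adding moreover [- u^2], the hyperbolic plane
   [s^2 - u^2] changes the number of zeros in a way that can be undone, so that only
   the zeros of a diagonal form in [t + 2] variables are needed. *)

(** * Zeros of quadratic forms over a finite field *)

Section QuadraticCharacter.
Variable F : finFieldType.
Hypothesis F_odd : 2%:R != 0 :> F.
Local Notation q := (#|F|%:R : int).

(** The quadratic character, extended by 0; integer values let sums of it count points. *)
Definition qchar (c : F) : int :=
  if c == 0 then 0 else if [exists x, x ^+ 2 == c] then 1 else -1.

Lemma card_sqrt c : \sum_(x : F) (x ^+ 2 == c)%:R = 1 + qchar c.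
Proof.
rewrite /qchar; case: eqP => [->|/eqP c0].
  rewrite addr0 (bigD1 0) //= expr0n eqxx big1 ?addr0 // => x x0.
  by rewrite sqrf_eq0 (negbTE x0).
case: existsP => [[y /eqP yc]|nex]; last first.
  by rewrite subrr big1 // => x _; case: eqP => // xc; case: nex; exists x; apply/eqP.
have y0 : y != 0 by apply: contraNneq c0 => y0; rewrite -yc y0 expr0n.
have yNy : - y != y.
  by rewrite -subr_eq0 -opprD oppr_eq0 -mulr2n -mulr_natl mulf_neq0.
rewrite (bigD1 y) //= yc eqxx (bigD1 (- y)) //= sqrrN yc eqxx big1 ?addr0 // => x.
by move=> /andP[xy xNy]; rewrite -yc eqf_sqr (negbTE xy) (negbTE xNy).
Qed.

(** Sorting the elements of [F] by their squares gives q as the sum of all [1 + qchar c]. *)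
Lemma sum_qchar : \sum_c qchar c = 0.
Proof.
have : \sum_(c : F) \sum_(x : F) (x ^+ 2 == c)%:R = q.
  rewrite exchange_big /= -sumr_const; apply: eq_bigr => x _.
  by rewrite (bigD1 (x ^+ 2)) //= eqxx big1 ?addr0 // => c; rewrite eq_sym => /negbTE->.
under eq_bigr do rewrite card_sqrt.
by rewrite big_split /= sumr_const => /eqP; rewrite -subr_eq0 addrAC subrr add0r => /eqP.
Qed.

Lemma qchar0 : qchar 0 = 0. Proof. by rewrite /qchar eqxx. Qed.

Lemma qchar_sqr x : x != 0 -> qchar (x ^+ 2) = 1.
Proof.
by move=> x0; rewrite /qchar sqrf_eq0 (negbTE x0); case: existsP => // -[]; exists x.
Qed.

Lemma qchar_neq0 c : c != 0 -> qchar c = 1 \/ qchar c = -1.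
Proof. by rewrite /qchar => /negbTE->; case: ifP; [left|right]. Qed.

Lemma qchar1_sqr c : qchar c = 1 -> exists2 x, x != 0 & x ^+ 2 = c.
Proof.
rewrite /qchar; have [//|c0] := eqVneq c 0; case: existsP => // -[x /eqP xc] _.
by exists x => //; apply: contraNneq c0 => x0; rewrite -xc x0 expr0n.
Qed.

Lemma qcharM_sq x c : x != 0 -> qchar (x ^+ 2 * c) = qchar c.
Proof.
move=> x0; rewrite /qchar mulf_eq0 sqrf_eq0 (negbTE x0) /=; case: eqP => // _.
congr (if _ then _ else _); apply/existsP/existsP => -[y /eqP yc].
  by exists (y / x); rewrite expr_div_n yc mulrC mulKf // expf_neq0.
by exists (x * y); rewrite exprMn yc.
Qed.

Lemma sum_qcharM (a : F) : a != 0 -> \sum_c qchar (a * c) = 0.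
Proof.
move=> a0; rewrite (reindex (fun c => a^-1 * c)).
  by rewrite -[RHS]sum_qchar; apply: eq_bigr => c _; rewrite mulVKf.
by exists (fun c => a * c) => c _; [rewrite mulVKf|rewrite mulKf].
Qed.

(* If [a] and [b] are nonsquares, all terms of [sum_c (qchar (a c) + qchar c) = 0]
   are nonpositive, hence the term of index [b] vanishes. *)
Lemma qcharM a b : qchar (a * b) = qchar a * qchar b.
Proof.
have [->|a0] := eqVneq a 0; first by rewrite mul0r qchar0 mul0r.
have [->|b0] := eqVneq b 0; first by rewrite mulr0 qchar0 mulr0.
have [a1|aN1] := qchar_neq0 a0.
  by have [x x0 xa] := qchar1_sqr a1; rewrite a1 mul1r -xa qcharM_sq.
have [b1|bN1] := qchar_neq0 b0.
  by have [x x0 xb] := qchar1_sqr b1; rewrite b1 mulr1 mulrC -xb qcharM_sq.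
have le0 c : 0 <= - (qchar (a * c) + qchar c).
  have [->|c0] := eqVneq c 0; first by rewrite mulr0 qchar0.
  have [c1|->] := qchar_neq0 c0.
    have [x x0 xc] := qchar1_sqr c1.
    by rewrite c1 mulrC -xc qcharM_sq // aN1.
  by have [->|->] := qchar_neq0 (mulf_neq0 a0 c0).
have sum0 : \sum_c - (qchar (a * c) + qchar c) = 0.
  by rewrite sumrN big_split /= sum_qchar sum_qcharM // addr0 oppr0.
have /eqP := sum0; rewrite psumr_eq0 // => /allP/(_ b (mem_index_enum b)).
by rewrite /= oppr_eq0 addr_eq0 aN1 bN1 mulrNN mulr1 opprK => /eqP.
Qed.

(* Counts the points of the hyperbola [(y - x) (y + x) = k]. *)
Lemma sum_qchar_sqrD k : \sum_x qchar (x ^+ 2 + k) = q * (k == 0)%:R - 1.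
Proof.
have [->|k0] := eqVneq k 0.
  rewrite (bigD1 0) //= expr0n addr0 qchar0 add0r mulr1.
  rewrite -[q]/(#|{: F}|%:R) -sumr_const [in RHS](bigD1 0) //= addrAC subrr add0r.
  apply: eq_bigr => x x0; by rewrite addr0 qchar_sqr.
rewrite mulr0 add0r.
have : \sum_(x : F) \sum_(y : F) (y ^+ 2 == x ^+ 2 + k)%:R = q - 1.
  rewrite pair_big /=.
  (* The inverse substitution is u = x + y, v = y - x. The equation becomes u v = k, with no
     solution for u = 0 and one for each other u. *)
  rewrite (reindex (fun uv : F * F =>
    ((uv.1 - uv.2) / 2%:R, (uv.1 + uv.2) / 2%:R))); last first.
    exists (fun xy => (xy.1 + xy.2, xy.2 - xy.1)) => -[x y] _ /=; congr pair; by field.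
  rewrite -(pair_big xpredT xpredT
    (fun u v => (((u + v) / 2%:R) ^+ 2 == ((u - v) / 2%:R) ^+ 2 + k)%:R)) /=.
  have uvE u v : (((u + v) / 2%:R) ^+ 2 == ((u - v) / 2%:R) ^+ 2 + k) = (u * v == k).
    by rewrite -subr_eq0 -[RHS]subr_eq0; congr (_ == 0); field.
  rewrite (bigD1 0) //= big1 ?add0r => [|v _]; last first.
    by rewrite uvE mul0r eq_sym (negbTE k0).
  rewrite -[q]/(#|{: F}|%:R) -sumr_const [in RHS](bigD1 0) //= addrAC subrr add0r.
  apply: eq_bigr => u u0; rewrite (bigD1 (k / u)) //= uvE mulrCA mulfV // mulr1 eqxx.
  rewrite big1 ?addr0 // => v; rewrite uvE => vN; case: eqP => // uvk.
  by rewrite -uvk mulrAC mulfV // mul1r eqxx in vN.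
under eq_bigr do rewrite card_sqrt.
by rewrite big_split /= sumr_const => /addrI.
Qed.

(** Up to a sign and a power of q, how far the number of solutions of a diagonal equation in n
    variables with right-hand side c is from its mean over c. *)
Definition qphi n c : int := if odd n then qchar c else q * (c == 0)%:R - 1.

(** A new variable s replaces c by c - a s^2. For odd n, factoring out -a leaves the sum over a
    hyperbola; for even n, the sum counts the square roots of c / a. *)
Lemma sum_qphi n (a : F) : a != 0 -> exists2 eta : int, eta = 1 \/ eta = -1 &
  forall c, q ^+ uphalf n * \sum_s qphi n (c - a * s ^+ 2) =
  eta * q ^+ uphalf n.+1 * qphi n.+1 c.
Proof.
move=> a0; rewrite /qphi /= uphalf_half; case: odd => /=.
  have Na0 : - a != 0 by rewrite oppr_eq0.
  exists (qchar (- a)); first exact: qchar_neq0.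
  move=> c; rewrite [_ * q ^+ _]mulrC -mulrA; congr (_ * _).
  have cE s : c - a * s ^+ 2 = - a * (s ^+ 2 + (- c / a)) by field.
  under eq_bigr do rewrite cE qcharM.
  by rewrite -mulr_sumr sum_qchar_sqrD mulf_eq0 invr_eq0 (negbTE a0) orbF oppr_eq0.
exists (qchar a); first exact: qchar_neq0.
move=> c; rewrite sumrB sumr_const -mulr_sumr.
have cE s : (c - a * s ^+ 2 == 0) = (s ^+ 2 == c / a).
  by rewrite subr_eq0; apply/eqP/eqP => ->; field.
under eq_bigr do rewrite cE.
have -> : c / a = a^-1 ^+ 2 * (a * c) by field.
rewrite card_sqrt qcharM_sq ?invr_eq0 // qcharM exprS; ring.
Qed.

Lemma sum_rV0 (G : 'rV[F]_0 -> int) : \sum_z G z = G 0.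
Proof. by rewrite (bigD1 0) //= big1 ?addr0 // => z; rewrite [z]thinmx0 eqxx. Qed.

Lemma sum_rV_recl n (G : 'rV[F]_n.+1 -> int) :
  \sum_z G z = \sum_s \sum_y G (row_mx (const_mx s : 'rV_1) y).
Proof.
rewrite pair_big /= (reindex (fun sy => row_mx (const_mx sy.1 : 'rV_1) sy.2)) //=.
exists (fun z : 'rV[F]_(1 + n) => (z 0 0, rsubmx z)) => [[s y]|z] _ /=.
  by rewrite row_mxKr mxE; case: splitP => // j _; rewrite mxE.
rewrite -[RHS]hsubmxK; congr row_mx; apply/rowP => i.
by rewrite !mxE ord1; congr (z _ _); apply: val_inj.
Qed.

Definition diagq n (a x : 'rV[F]_n) : F := \sum_k a 0 k * x 0 k ^+ 2.

Lemma diagq_recl n (a : 'rV[F]_n.+1) s (y : 'rV[F]_n) :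
  diagq a (row_mx (const_mx s : 'rV_1) y) =
  a 0 0 * s ^+ 2 + diagq (rsubmx (a : 'rV_(1 + n))) y.
Proof.
rewrite /diagq big_ord_recl mxE; congr (_ * _ ^+ 2 + _).
  by case: splitP => // j _; rewrite mxE.
apply: eq_bigr => k _; rewrite [rsubmx _ _ _]mxE.
have -> : lift ord0 k = rshift 1 k by apply: val_inj.
by congr (_ * _ ^+ 2); apply: row_mxEr.
Qed.

(** Induction splitting off the first variable. The factor q avoids the exponent n - 1 and lets the
    induction start at the empty form, where q [c = 0] = 1 + (q [c = 0] - 1). *)
Lemma card_diagq n (a : 'rV[F]_n) : (forall k, a 0 k != 0) ->
  exists2 eta : int, eta = 1 \/ eta = -1 & forall c,
  q * \sum_x (diagq a x == c)%:R = q ^+ n + eta * q ^+ uphalf n * qphi n c.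
Proof.
elim: n a => [|n IHn] a a0.
  exists 1 => [|c]; first by left.
  by rewrite sum_rV0 /diagq big_ord0 /qphi /= eq_sym !expr0; ring.
have [k|eta eta1 IH] := IHn (rsubmx (a : 'rV_(1 + n))); first by rewrite mxE.
have [eta' eta'1 sumE] := sum_qphi n (a0 0).
exists (eta * eta') => [|c].
  by case: eta1 eta'1 => -> [] ->; rewrite ?mulN1r ?mul1r ?opprK; [left|right|right|left].
transitivity (\sum_s (q ^+ n + eta * q ^+ uphalf n * qphi n (c - a 0 0 * s ^+ 2))).
  rewrite sum_rV_recl mulr_sumr; apply: eq_bigr => s _; rewrite -IH; congr (_ * _).
  by apply: eq_bigr => y _; rewrite diagq_recl addrC [in RHS]eq_sym subr_eq eq_sym.
rewrite big_split /= sumr_const -mulr_sumr -mulrA sumE -mulr_natr exprSr; ring.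
Qed.

(** * The cone r (x . x) = (v . x)^2 *)

Section Cone.
Variables (t : nat) (r : F) (v : 'rV[F]_t).
Let Q (x : 'rV[F]_t) := r * (\sum_k x 0 k ^+ 2) - (\sum_k v 0 k * x 0 k) ^+ 2.

(** For w = (1, v), of square r, the form r (z . z) - (w . z)^2 is unchanged when multiples of w are
    added to z. Moving z along w until its first coordinate is 0 gives [Q y], and s is w . z. *)
Lemma sum_coneE (G : F -> int) : r != 0 -> r = 1 + \sum_k v 0 k ^+ 2 ->
  \sum_y \sum_s G (Q y + s ^+ 2) = \sum_z G (diagq (const_mx r : 'rV_t.+1) z).
Proof.
move=> r0 rE; rewrite sum_rV_recl pair_big [RHS]pair_big /=.
pose dot (x : 'rV[F]_t) := \sum_k v 0 k * x 0 k.
have dotD x c : dot (x + c *: v) = dot x + c * (r - 1).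
  rewrite rE [1 + _]addrC addrK mulr_sumr -big_split; apply: eq_bigr => k _.
  by rewrite !mxE /=; ring.
rewrite (reindex (fun z : F * 'rV[F]_t => (z.2 - z.1 *: v, z.1 + dot z.2))) /=; last first.
  (* With y = z - z0 v and s = z0 + v . z, one has s - v . y = r z0, because v . v = r - 1. *)
  exists (fun ys => let z0 := (ys.2 - dot ys.1) / r in (z0, ys.1 + z0 *: v)).
    move=> [z0 z] _ /=; rewrite -scaleNr dotD.
    have -> : (z0 + dot z - (dot z + - z0 * (r - 1))) / r = z0 by field.
    by rewrite scaleNr subrK.
  move=> [y s] _ /=; rewrite dotD addrK; congr pair; by field.
apply: eq_bigr => -[z0 z] _; congr G; rewrite diagq_recl /= !mxE /Q -/(dot _) -scaleNr dotD.
have -> : \sum_k (z + - z0 *: v) 0 k ^+ 2 =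
    \sum_k z 0 k ^+ 2 - 2%:R * z0 * dot z + z0 ^+ 2 * (r - 1).
  rewrite rE [1 + _]addrC addrK !mulr_sumr -sumrN -!big_split; apply: eq_bigr => k _ /=.
  by rewrite !mxE; ring.
have -> : diagq (rsubmx (const_mx r : 'rV_(1 + t))) z = r * \sum_k z 0 k ^+ 2.
  by rewrite mulr_sumr; apply: eq_bigr => k _; rewrite !mxE.
ring.
Qed.

(** For fixed y, u^2 = s^2 + Q y has q - 1 + q [Q y = 0] solutions (s, u), so the zeros of the
    enlarged form determine those of Q. With s^2 alone, the contribution of y would also involve the
    character of - Q y. *)
Lemma card_cone : r != 0 -> r = 1 + \sum_k v 0 k ^+ 2 ->
  exists2 eta : int, eta = 1 \/ eta = -1 &
  q * \sum_x (Q x == 0)%:R =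
  q ^+ t + if odd t then 0 else eta * q ^+ t./2 * (q - 1).
Proof.
move=> r0 rE.
have q0 : q != 0 by rewrite pnatr_eq0 -lt0n; apply/card_gt0P; exists 0.
pose a : 'rV[F]_t.+2 := row_mx (const_mx (-1) : 'rV_1) (const_mx r).
have [k|eta eta1 /(_ 0)] := @card_diagq _ a.
  rewrite !mxE; case: splitP => j _; rewrite mxE //.
  by rewrite oppr_eq0 oner_eq0.
have -> : \sum_x (diagq a x == 0)%:R = (q - 1) * q ^+ t + q * \sum_x (Q x == 0)%:R.
  rewrite sum_rV_recl.
  transitivity (\sum_u \sum_y \sum_s (u ^+ 2 == s ^+ 2 + Q y)%:R : int).
    apply: eq_bigr => u _.
    transitivity (\sum_z (u ^+ 2 == diagq (const_mx r : 'rV_t.+1) z)%:R : int).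
      apply: eq_bigr => z _; rewrite diagq_recl row_mxKr mxE.
      case: splitP => // j _; rewrite mxE mulN1r addrC subr_eq0 eq_sym //.
    rewrite -(sum_coneE (fun c => (u ^+ 2 == c)%:R)) //.
    by apply: eq_bigr => y _; apply: eq_bigr => s _; rewrite addrC.
  rewrite exchange_big /=.
  transitivity (\sum_y (q - 1 + q * (Q y == 0)%:R)).
    apply: eq_bigr => y _; rewrite exchange_big /=.
    under eq_bigr do rewrite card_sqrt.
    by rewrite big_split /= sumr_const sum_qchar_sqrD addrA addrAC.
  rewrite big_split /= sumr_const -mulr_sumr card_mx mul1n.
  by rewrite -[X in X + _ = _]mulr_natr natrX.
set N := \sum_x _; rewrite /qphi /= uphalf_half negbK eqxx mulr1 => NE.
exists eta => //; apply: (mulfI q0); apply: (addrI (q * ((q - 1) * q ^+ t))).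
rewrite -mulrDr NE.
(* The value of [qphi t.+2] at 0 is 0 for odd t and q - 1 for even t. *)
by case: odd; rewrite /= ?qchar0 ?add0n ?add1n !exprS; ring.
Qed.

End Cone.

(** Translation by [w c], where v . w c = c, identifies the level sets of the linear form; the q of
    them partition the space. *)
Lemma card_hyperplane t (v : 'rV[F]_t) : v != 0 ->
  q * \sum_(x : 'rV_t) (\sum_k v 0 k * x 0 k == 0)%:R = q ^+ t.
Proof.
move=> /rV0Pn[k vk0]; pose w c : 'rV[F]_t := (c / v 0 k) *: delta_mx 0 k.
transitivity (\sum_c \sum_(x : 'rV[F]_t) (\sum_k v 0 k * x 0 k + c == 0)%:R : int).
  rewrite mulr_natl -sumr_const; apply: eq_bigr => c _.
  rewrite (reindex_inj (addIr (w c))); apply: eq_bigr => x _; congr (_ == _)%:R.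
  under eq_bigr do rewrite mxE mulrDr.
  rewrite big_split /=; congr (_ + _); rewrite (bigD1 k) //= !mxE !eqxx mulr1.
  rewrite big1 ?addr0 => [|j jk]; first by rewrite mulrC divfK.
  by rewrite !mxE (negbTE jk) andbF !mulr0.
rewrite exchange_big /=.
transitivity (\sum_(x : 'rV[F]_t) 1 : int); last first.
  by rewrite sumr_const card_mx mul1n natrX.
apply: eq_bigr => x _; rewrite (bigD1 (- \sum_k v 0 k * x 0 k)) //= subrr eqxx.
by rewrite big1 ?addr0 // => c; rewrite -addr_eq0 addrC => /negbTE ->.
Qed.

End QuadraticCharacter.

(** * l-adic integers and the characteristic series *)

Lemma det_mx22 (R : comNzRingType) (A : 'M[R]_2) :
  \det A = A 0 0 * A 1 1 - A 0 1 * A 1 0.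
Proof.
rewrite (expand_det_row _ 0) !big_ord_recl big_ord0 addr0 /cofactor !det_mx11 !mxE.
rewrite /= expr0 expr1 mul1r mulN1r mulrN.
by congr (A _ _ * A _ _ - A _ _ * A _ _); apply/val_inj.
Qed.

Section PadicResidue.
Variable l : nat.
Hypothesis l_pr : prime l.
Local Notation Zl := (padic_int l).

Let l_gt1 := prime_gt1 l_pr.

Lemma Zp_cast_expn n : (Zp_trunc (l ^ n.+1)).+2 = (l ^ n.+1)%N.
Proof. by rewrite Zp_cast // -(expn0 l) ltn_exp2l. Qed.

Lemma modn_Zp_expn k n : (k %% (Zp_trunc (l ^ n.+1)).+2 = k %% l ^ n.+1)%N.
Proof. by rewrite Zp_cast_expn. Qed.

Lemma modn_Zp1 k : (k %% (Zp_trunc (l ^ 1)).+2 = k %% l)%N.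
Proof. by rewrite modn_Zp_expn expn1. Qed.

Lemma padic_nat_mod (x : Zl) n : (x n.+1 %% l ^ n.+1)%N = x n.
Proof. by rewrite -[in RHS](pres_compat x n); rewrite /= modn_Zp_expn. Qed.

Definition residue (x : Zl) : 'F_l := (x 0%N)%:R.

Lemma residue_is_monoid_morphism : monoid_morphism residue.
Proof.
split=> [|x y]; rewrite /residue /=.
  by rewrite modn_small.
by rewrite modn_Zp1 Fp_nat_mod // natrM.
Qed.

Lemma residue_is_zmod_morphism : zmod_morphism residue.
Proof.
have addE x y : residue (x + y) = residue x + residue y.
  by rewrite /residue /= modn_Zp1 Fp_nat_mod // natrD.
move=> x y; apply/eqP; rewrite eq_sym subr_eq -addE subrK //.
Qed.

HB.instance Definition _ := GRing.isZmodMorphism.Build Zl 'F_l residue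
  residue_is_zmod_morphism.
HB.instance Definition _ := GRing.isMonoidMorphism.Build Zl 'F_l residue
  residue_is_monoid_morphism.

Lemma residue_nat n : residue n%:R = n%:R. Proof. exact: rmorph_nat. Qed.

Lemma residue_val (x : Zl) : (residue x : nat) = x 0%N.
Proof. by rewrite /residue val_Fp_nat // -modn_Zp1 modn_small. Qed.

Lemma padic_modl (x : Zl) n : (x n %% l)%N = residue x.
Proof.
rewrite residue_val; elim: n => [|n IHn]; first by rewrite -modn_Zp1 modn_small.
by rewrite -IHn -(padic_nat_mod x n) modn_dvdm // dvdn_exp.
Qed.

Lemma pres_nat k n : ((k%:R : Zl) n : nat) = (k %% l ^ n.+1)%N.
Proof.
have -> : (k%:R : Zl) n = k%:R.
  by elim: k => // k IHk; rewrite -!natr1 /= IHk.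
by rewrite val_Zp_nat // -(expn0 l) ltn_exp2l.
Qed.

(** If the residue is 0, every component of x is divisible by l. Dividing loses one power of l, so
    component n of x / l comes from component n + 1 of x. *)
Lemma residue_eq0 (x : Zl) : residue x = 0 <-> lideal x.
Proof.
split=> [/(congr1 val)|[c ->]]; last first.
  by rewrite rmorphM rmorph_nat pchar_Fp_0 // mul0r.
move=> x0.
have dvd n : (l %| x n)%N by rewrite /dvdn padic_modl x0.
pose c n : 'Z_(l ^ n.+1) := inZp (x n.+1 %/ l)%N.
have cE n : (c n : nat) = (x n.+1 %/ l)%N.
  rewrite /= modn_Zp_expn modn_small // ltn_divLR ?prime_gt0 //.
  by rewrite -expnSr -[ltnRHS]Zp_cast_expn.
have cP n : inZp (c n.+1) = c n.
  apply/val_inj; transitivity (c n.+1 %% (Zp_trunc (l ^ n.+1)).+2)%N => //.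
  by rewrite modn_Zp_expn cE modn_divl -expnSr padic_nat_mod -cE.
exists (PadicInt cP); apply: padicP => n.
apply/val_inj.
transitivity ((pres (l%:R : Zl) n * c n) %% (Zp_trunc (l ^ n.+1)).+2)%N => //.
by rewrite modn_Zp_expn pres_nat modnMml cE mulnC divnK // padic_nat_mod.
Qed.

Lemma residue_unit (x : Zl) : residue x != 0 -> x \is a GRing.unit.
Proof.
move=> x0.
have xU n : x n \is a GRing.unit.
  rewrite -[x n]natr_Zp unitZpE; last by rewrite -(expn0 l) ltn_exp2l.
  rewrite coprimeXl // prime_coprime // /dvdn padic_modl.
  by apply: contraNN x0 => /eqP x0; apply/eqP/val_inj.
have cP n : inZp (x n.+1)^-1 = (x n)^-1 :> 'Z_(l ^ n.+1).
  apply: (mulrI (xU n)); rewrite (mulrV (xU n)).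
  by rewrite -{1}(pres_compat x n) -[RHS]red1 -[in RHS](mulrV (xU n.+1)) redM.
apply/asboolP; exists (@PadicInt l (fun n => (x n)^-1) cP).
by apply: padicP => n; apply: mulVr (xU n).
Qed.

Lemma lunit_residue (x : Zl) : x \is a GRing.unit -> residue x != 0.
Proof. by move=> xU; rewrite -unitfE rmorph_unit. Qed.

(** When n! is a unit the quotient exists, so [xget] finds it. For odd l this covers n up to 2,
    enough for the coefficients up to T^2. *)
Lemma factorial_padic_binom b n : residue (n`!)%:R != 0 ->
  (n`!)%:R * padic_binom b n = \prod_(i < n) (b - i%:R) :> Zl.
Proof.
move=> /residue_unit nU; apply: (@xgetPex _ 0 [set c | (n`!)%:R * c = _]%classic).
by exists ((n`!)%:R^-1 * \prod_(i < n) (b - i%:R)); rewrite /= mulVKr.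
Qed.

(** * Coefficients and units of power series *)

Section Coef.
Variable R : comNzRingType.
Implicit Types f g : Defs.pseries R.

Lemma pscoefD f g n : pscoef (f + g) n = pscoef f n + pscoef g n.
Proof. by []. Qed.

Lemma pscoefN f n : pscoef (- f) n = - pscoef f n.
Proof. by []. Qed.

Lemma pscoef_sum I (s : seq I) (F : I -> Defs.pseries R) n :
  pscoef (\sum_(i <- s) F i) n = \sum_(i <- s) pscoef (F i) n.
Proof. by elim/big_rec2: _ => // i y g _ <-. Qed.

Lemma pscoefMn f k n : pscoef (f *+ k) n = pscoef f n *+ k.
Proof. by elim: k => // k IHk; rewrite !mulrS pscoefD IHk. Qed.

Lemma pscoef_nat k n : pscoef (k%:R : Defs.pseries R) n = (k * (n == 0))%:R.
Proof. by rewrite pscoefMn /= natrM mulr_natl. Qed.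

Lemma pscoefM f g n :
  pscoef (f * g) n = \sum_(i < n.+1) pscoef f i * pscoef g (n - i)%N.
Proof. by []. Qed.

(** The first n coefficients of the inverse of f, when c inverts its constant term; a list, because
    each one is computed from all earlier ones. *)
Fixpoint ps_inv_seq (f : Defs.pseries R) (c : R) n : seq R :=
  if n is m.+1 then
    let s := ps_inv_seq f c m in
    rcons s (c * ((m == 0)%:R - \sum_(i < m) s`_i * pscoef f (m - i)%N))
  else [::].

Lemma size_ps_inv_seq f c n : size (ps_inv_seq f c n) = n.
Proof. by elim: n => //= n IHn; rewrite size_rcons IHn. Qed.

Lemma nth_ps_inv_seq f c n k : (k < n)%N ->
  (ps_inv_seq f c n)`_k = (ps_inv_seq f c k.+1)`_k.
Proof.
elim: n => // n IHn; rewrite ltnS leq_eqVlt => /predU1P[->//|kn].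
by rewrite /= nth_rcons size_ps_inv_seq kn IHn.
Qed.

Lemma ps_unit f : (exists c, c * pscoef f 0 = 1) -> f \is a GRing.unit.
Proof.
move=> [c cf]; apply/asboolP; exists (PSeries (fun n => (ps_inv_seq f c n.+1)`_n)).
apply: pseriesP => n; rewrite pscoefM big_ord_recr /= subnn.
rewrite nth_rcons size_ps_inv_seq ltnn eqxx mulrAC cf mul1r addrC.
rewrite -[RHS](subrK (\sum_(i < n) (ps_inv_seq f c n)`_i * pscoef f (n - i)%N)).
congr (_ + _); apply: eq_bigr => i _; congr (_ * _).
by rewrite [RHS]nth_ps_inv_seq.
Qed.

Lemma ps_unit_coef0 f : f \is a GRing.unit -> exists c, c * pscoef f 0 = 1.
Proof.
move=> /asboolP[g gf]; exists (pscoef g 0).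
by move/(congr1 (fun h => pscoef h 0)): gf; rewrite pscoefM big_ord_recl big_ord0 addr0.
Qed.

End Coef.

(** * Reading mu and lambda off the coefficients modulo l *)

Lemma weierstrass_mu0 f mu h u n : weierstrass f (mu, h, u) ->
  residue (pscoef f n) != 0 -> mu = 0%N.
Proof.
move=> [_ _ ->]; case: mu => // mu; rewrite exprS -!mulrA mulr_natl pscoefMn.
by rewrite -[pscoef _ _ *+ l]mulr_natr rmorphM rmorph_nat pchar_Fp_0 // mulr0 eqxx.
Qed.

(** Modulo l, h becomes T^d with d its degree, so f reduces to T^d u. *)
Lemma weierstrass_residue f h u : weierstrass f (0%N, h, u) ->
  residue (pscoef f (size h).-1) != 0 /\
  forall i, (i < (size h).-1)%N -> residue (pscoef f i) = 0.
Proof.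
move=> [[h_mon hl] uU ->]; rewrite expr0 mul1r.
have coefE i : (i <= (size h).-1)%N ->
    residue (pscoef (ps_of_poly h * u) i) =
    (i == (size h).-1)%:R * residue (pscoef u 0).
  move=> ih; rewrite pscoefM rmorph_sum big_ord_recr /= subnn big1 => [|j _].
    rewrite add0r rmorphM /=; move: ih; rewrite leq_eqVlt => /predU1P[->|ih].
      by rewrite eqxx -/(lead_coef h) (monicP h_mon) rmorph1.
    by rewrite (ltn_eqF ih) mul0r (residue_eq0 h`_i).2 ?mul0r //; apply: hl.
  rewrite rmorphM /= (residue_eq0 h`_j).2 ?mul0r //; apply: hl.
  exact: leq_trans (ltn_ord j) ih.
split=> [|i ih]; last by rewrite coefE ?(ltnW ih) // (ltn_eqF ih) mul0r.
rewrite coefE // eqxx mul1r.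
have [c cu] := ps_unit_coef0 uU.
by apply: lunit_residue; apply/asboolP; exists c.
Qed.

(** Provides the existence of a decomposition when f is T^n times a unit. *)
Lemma weierstrass_shift f n : (forall i, (i < n)%N -> pscoef f i = 0) ->
  residue (pscoef f n) != 0 ->
  weierstrass f (0%N, 'X^n, PSeries (fun k => pscoef f (n + k))).
Proof.
move=> f0 fn; split.
- split; first exact: monicXn.
  move=> i; rewrite size_polyXn /= coefXn => /ltn_eqF ->.
  by exists 0; rewrite mulr0.
- apply: ps_unit; rewrite /= addn0; exists (pscoef f n)^-1.
  by rewrite mulVr // residue_unit.
rewrite expr0 mul1r; apply: pseriesP => k; rewrite pscoefM /=.
have [kn|nk] := ltnP k n.
  rewrite f0 // big1 // => i _; rewrite coefXn ltn_eqF ?mul0r //.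
  exact: leq_trans (ltn_ord i) kn.
rewrite (bigD1 (Ordinal (nk : (n < k.+1)%N))) //= coefXn eqxx mul1r subnKC //.
rewrite big1 ?addr0 // => i; rewrite -val_eqE coefXn /= => /negbTE ->.
by rewrite mul0r.
Qed.

(** Whichever decomposition [weierstrass_dec] picks, once mu = 0 the degree of h is the first index
    with nonzero residue; lambda = 1 means degree 2. *)
Lemma mu0_lambda1P (f : Defs.pseries Zl) : pscoef f 0 = 0 -> pscoef f 1 = 0 ->
  (mu_inv f = 0%N /\ lambda_inv f = 1) <-> residue (pscoef f 2) != 0.
Proof.
move=> f0 f1; rewrite /mu_inv /lambda_inv; split.
  (* The default value has h = 0, hence lambda = -1, which is not 1. *)
  rewrite /weierstrass_dec; case: xgetP => [w _ fw [w0 /eqP]|_ [_]]; last first.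
    by rewrite size_poly0.
  case: w fw w0 => [[mu h] u] fw /= mu0; rewrite mu0 in fw.
  by rewrite subr_eq => /eqP[hE]; have [+ _] := weierstrass_residue fw; rewrite hE.
move=> f2; case E : (weierstrass_dec f) => [[mu h] u] /=.
have fw : weierstrass f (mu, h, u).
  rewrite -E; apply: (@xgetPex _ (0%N, 0, 0) (weierstrass f)).
  eexists; apply: (@weierstrass_shift f 2) => //.
  by case=> [|[|]].
have mu0 := weierstrass_mu0 fw f2; rewrite mu0 in fw *.
have [fn fi] := weierstrass_residue fw; split=> //.
(* The degree is at most 2 since all coefficients below it vanish modulo l, and it is not 0 or 1
   since the coefficient at it does not. *)
have : ~~ (2 < (size h).-1)%N by apply: contraNN f2 => /fi ->.
by move: fn; case: (size h).-1 => [|[|[|k]]]; rewrite ?f0 ?f1 ?rmorph0 ?eqxx.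
Qed.

Hypothesis l_odd : odd l.

Lemma residue2_neq0 : residue 2%:R != 0.
Proof.
rewrite rmorph_nat -(dvdn_pcharf (pchar_Fp l_pr)) dvdn_prime2 //.
by apply: contraTneq l_odd => ->.
Qed.

Lemma padic_double_inj : injective (fun x : Zl => 2%:R * x).
Proof. exact/mulrI/residue_unit/residue2_neq0. Qed.

Lemma padic_binom0 b : padic_binom b 0 = 1 :> Zl.
Proof.
have := @factorial_padic_binom b 0; rewrite fact0 mul1r big_ord0; apply.
by rewrite rmorph1 oner_eq0.
Qed.

Lemma padic_binom1 b : padic_binom b 1 = b :> Zl.
Proof.
have := @factorial_padic_binom b 1; rewrite mul1r big_ord1 subr0; apply.
by rewrite rmorph1 oner_eq0.
Qed.

Lemma padic_binom2 b : 2%:R * padic_binom b 2 = b * (b - 1) :> Zl.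
Proof.
have := @factorial_padic_binom b 2; rewrite !big_ord_recl big_ord0 mulr1 subr0; apply.
exact: residue2_neq0.
Qed.

Lemma padic_binom2N b : padic_binom b 2 + padic_binom (- b) 2 = b ^+ 2 :> Zl.
Proof. by apply: padic_double_inj; rewrite mulrDr !padic_binom2; ring. Qed.

(** * The characteristic series up to T^2 *)

Section CharSeries.
Variables (p q e g : nat) (alpha : voltage l p q e g).
Local Notation r := ((e + g)%:R : Zl).
Let beta := \sum_i vb alpha i - \sum_i vc alpha i.

Lemma loop_term_coef (x : Zl) : [/\ pscoef (loop_term x) 0 = 0,
  pscoef (loop_term x) 1 = 0 & pscoef (loop_term x) 2 = - x ^+ 2].
Proof.
split; rewrite /loop_term pscoefD pscoefN pscoefD pscoefN pscoef_nat /=.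
- by rewrite !padic_binom0; ring.
- by rewrite !padic_binom1; ring.
- by rewrite -padic_binom2N; ring.
Qed.

Lemma char_seriesE : char_series alpha =
  m11 alpha * m22 alpha - m12 alpha * m21 alpha.
Proof. by rewrite /char_series det_mx22 !mxE. Qed.

(** Both off-diagonal entries have constant term -r, so their T^2 coefficients enter only through
    their sum, in which the binomials combine to squares. Their T coefficients are opposite and
    produce [beta ^+ 2]. *)
Lemma char_series_coef : [/\ pscoef (char_series alpha) 0 = 0,
  pscoef (char_series alpha) 1 = 0 &
  pscoef (char_series alpha) 2 = beta ^+ 2 - r *
    (\sum_i va alpha i ^+ 2 + \sum_i vb alpha i ^+ 2 +
     \sum_i vc alpha i ^+ 2 + \sum_i vd alpha i ^+ 2)].
Proof.
have diagE n (a : 'I_n -> Zl) (f := (e + g)%:R + \sum_i loop_term (a i)) :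
    [/\ pscoef f 0 = r, pscoef f 1 = 0 & pscoef f 2 = - \sum_i a i ^+ 2].
  split; rewrite /f pscoefD pscoef_nat pscoef_sum.
  - by rewrite muln1 big1 ?addr0 // => i _; have [] := loop_term_coef (a i).
  - by rewrite muln0 add0r big1 // => i _; have [] := loop_term_coef (a i).
  - rewrite muln0 add0r -sumrN; apply: eq_bigr => i _.
    by have [] := loop_term_coef (a i).
have m12_0 : pscoef (m12 alpha) 0 = - r.
  rewrite pscoefN pscoefD !pscoef_sum /=.
  under eq_bigr do rewrite padic_binom0.
  under [X in _ + X]eq_bigr do rewrite padic_binom0.
  by rewrite !sumr_const !card_ord natrD.
have m21_0 : pscoef (m21 alpha) 0 = - r.
  rewrite pscoefN pscoefD !pscoef_sum /=.
  under eq_bigr do rewrite padic_binom0.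
  under [X in _ + X]eq_bigr do rewrite padic_binom0.
  by rewrite !sumr_const !card_ord natrD.
have m12_1 : pscoef (m12 alpha) 1 = - beta.
  rewrite pscoefN pscoefD !pscoef_sum /=.
  under eq_bigr do rewrite padic_binom1.
  under [X in _ + X]eq_bigr do rewrite padic_binom1.
  by rewrite sumrN.
have m21_1 : pscoef (m21 alpha) 1 = beta.
  rewrite pscoefN pscoefD !pscoef_sum /=.
  under eq_bigr do rewrite padic_binom1.
  under [X in _ + X]eq_bigr do rewrite padic_binom1.
  by rewrite sumrN opprD opprK.
have m_2 : pscoef (m12 alpha) 2 + pscoef (m21 alpha) 2 =
    - (\sum_i vb alpha i ^+ 2 + \sum_i vc alpha i ^+ 2).
  rewrite !pscoefN !pscoefD !pscoef_sum -opprD; congr (- _).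
  rewrite addrACA -!big_split /=; congr (_ + _); apply: eq_bigr => i _.
    by rewrite padic_binom2N.
  by rewrite addrC padic_binom2N.
have [a0 a1 a2] := diagE _ (va alpha); have [d0 d1 d2] := diagE _ (vd alpha).
rewrite char_seriesE; split; rewrite pscoefD pscoefN !pscoefM !big_ord_recl !big_ord0.
- rewrite a0 d0 m12_0 m21_0; ring.
- rewrite a0 a1 d0 d1 m12_0 m12_1 m21_0 m21_1; ring.
have m12_2 := canRL (addrK _) m_2.
rewrite a0 a1 a2 d0 d1 d2 m12_0 m12_1 m12_2 m21_0 m21_1; ring.
Qed.

End CharSeries.

(** * Coordinates of alpha_0 and orientation signs *)

Section VoltageOf.
Variables p q e g : nat.
Hypothesis e_gt0 : (0 < e)%N.
Local Notation t := (p + e.-1 + g + q)%N.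

(** The vector v, by position in alpha_0; as b_1 is dropped, the first block of edges has e - 1
    entries. Integer values serve both over [Zl] and over ['F_l]. *)
Definition edge_sign (k : nat) : int :=
  if (p <= k < p + e.-1)%N then 1
  else if (p + e.-1 <= k < p + e.-1 + g)%N then -1 else 0.

Lemma sum_blocks (V : zmodType) (G : nat -> V) :
  \sum_(k < t) G k = \sum_(i < p) G i + \sum_(i < e.-1) G (p + i)%N +
    \sum_(i < g) G (p + e.-1 + i)%N + \sum_(i < q) G (p + e.-1 + g + i)%N.
Proof. by rewrite !big_split_ord. Qed.

Lemma edge_sign_vb (i : 'I_e.-1) : edge_sign (p + i) = 1.
Proof. by rewrite /edge_sign leq_addr ltn_add2l ltn_ord. Qed.

Lemma edge_sign_vc (i : 'I_g) : edge_sign (p + e.-1 + i) = -1.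
Proof.
by rewrite /edge_sign (ltnNge _ (p + _)) !leq_addr andbF /= ltn_add2l ltn_ord.
Qed.

Lemma sum_edge_sign (V : zmodType) (G : nat -> V) :
  \sum_(k < t) G k *~ edge_sign k =
  \sum_(i < e.-1) G (p + i)%N - \sum_(i < g) G (p + e.-1 + i)%N.
Proof.
rewrite (sum_blocks (fun k => G k *~ edge_sign k)) -sumrN.
rewrite [X in X + _ + _ + _]big1 ?add0r => [|i _]; last first.
  rewrite /edge_sign leqNgt ltn_ord /= leqNgt.
  by rewrite (leq_trans (ltn_ord i)) ?leq_addr.
rewrite [X in _ + X]big1 ?addr0 => [|i _]; last first.
  by rewrite /edge_sign !ltnNge -!addnA !leq_add2l !leq_addr !andbF.
congr (_ + _); apply: eq_bigr => i _.
  by rewrite edge_sign_vb mulr1z.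
by rewrite edge_sign_vc mulrN1z.
Qed.

(** The summand 1 stands for the dropped edge, so that all r edges are counted. *)
Lemma sum_edge_sign_sqr : 1 + \sum_(k < t) edge_sign k ^+ 2 = (e + g)%:R.
Proof.
under eq_bigr do rewrite expr2 -[X in _ * X]intz mulrzr.
rewrite (sum_edge_sign edge_sign).
under eq_bigr do rewrite edge_sign_vb.
under [X in _ - X]eq_bigr do rewrite edge_sign_vc.
by rewrite sumrN opprK !sumr_const !card_ord addrA -mulrS -mulrnDr prednK.
Qed.

Lemma coordE n (a : 'rV[Zl]_n) (k : 'I_n) : Defs.coord a k = a 0 k.
Proof. by rewrite /Defs.coord valK. Qed.

Lemma sum_vb (G : Zl -> Zl) (a : 'rV[Zl]_t) : G 0 = 0 ->
  \sum_i G (vb (voltage_of p q e g a) i) = \sum_(i < e.-1) G (Defs.coord a (p + i)%N).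
Proof.
move=> G0; case: e e_gt0 a => // e' _ a.
by rewrite big_ord_recl /= G0 add0r.
Qed.

Lemma char_series_voltage_of (a : 'rV[Zl]_t)
    (f := char_series (voltage_of p q e g a)) :
  [/\ pscoef f 0 = 0, pscoef f 1 = 0 &
  pscoef f 2 = (\sum_k a 0 k *~ edge_sign k) ^+ 2 - (e + g)%:R * \sum_k a 0 k ^+ 2].
Proof.
have [f0 f1 f2] := char_series_coef (voltage_of p q e g a).
split=> //; rewrite {}f2.
under [in RHS]eq_bigr do rewrite -coordE.
under [X in _ = _ - _ * X]eq_bigr do rewrite -coordE.
rewrite (sum_edge_sign (Defs.coord a)) (sum_blocks (fun k => Defs.coord a k ^+ 2)).
rewrite (sum_vb (G := id)) // (sum_vb (G := fun x => x ^+ 2)) ?expr0n //.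
Qed.

End VoltageOf.

End PadicResidue.

(** * Haar measure and the residues modulo l *)

Section Haar.
Variables (l t : nat) (R : realType) (tau : probability (padic_space l t) R).
Hypothesis l_pr : prime l.
Hypothesis tau_haar : normalized_haar tau.
Local Notation Zl := (padic_int l).

Definition residue_rV (a : 'rV[Zl]_t) : 'rV['F_l]_t := \row_k residue (a 0 k).

Definition residue_set (S : {set 'rV['F_l]_t}) : set 'rV[Zl]_t :=
  [set a | residue_rV a \in S]%classic.

Lemma residue_set_open S : open (residue_set S).
Proof.
rewrite openE => a Sa.
(* In each coordinate, the class modulo l is a basic neighborhood, of level 0. *)
exists (fun i j => [set y : Zl | residue y = residue (a i j)]%classic).
  by move=> i j; exists 0%N => // y /= ya; rewrite /residue ya.
move=> b ba; rewrite /residue_set /=; suff -> : residue_rV b = residue_rV a by [].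
apply/rowP => k; rewrite !mxE; apply: ba.
Qed.

Lemma residue_set_measurable S : measurable (residue_set S : set (padic_space l t)).
Proof. by apply: sub_sigma_algebra; apply: residue_set_open. Qed.

Lemma residue_rV_nat (x : 'rV['F_l]_t) : residue_rV (\row_k (x 0 k : nat)%:R) = x.
Proof. by apply/rowP => k; rewrite !mxE residue_nat // natr_Zp. Qed.

Lemma residue_rVD a b : residue_rV (a + b) = residue_rV a + residue_rV b.
Proof. by apply/rowP => k; rewrite !mxE; apply: raddfD. Qed.

(** The fiber over x is the fiber over 0 translated by a lift of x with natural number entries. *)
Lemma haar_residue_set1 x : tau (residue_set [set x]) = tau (residue_set [set 0]).
Proof.
rewrite -(tau_haar (\row_k (x 0 k : nat)%:R) (residue_set_measurable [set 0])).
congr (tau _); apply/seteqP; split=> [a /set1P ax|_ [b /set1P b0 <-]].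
  exists (a - \row_k (x 0 k : nat)%:R); last by rewrite addrC subrK.
  apply/set1P/(addIr x); rewrite add0r -[X in _ + X = _]residue_rV_nat.
  by rewrite -residue_rVD subrK.
by apply/set1P; rewrite residue_rVD residue_rV_nat b0 addr0.
Qed.

Lemma haar_residue_setM S :
  (tau (residue_set S) = #|S|%:R%:E * tau (residue_set [set 0%R]))%E.
Proof.
have -> : residue_set S = (\bigcup_(x in [set` S]) residue_set [set x])%classic.
  apply/seteqP; split=> [a aS|a [x xS /set1P xa]]; last by rewrite /residue_set /= xa.
  by exists (residue_rV a) => //; apply/set1P.
rewrite measure_fin_bigcup //.
- rewrite (eq_fsbigr (fun=> tau (residue_set [set 0]))); last first.
    by move=> x _; apply: haar_residue_set1.
  rewrite (_ : [set` S]%classic = [set` enum S]%classic); last first.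
    by apply/seteqP; split=> x /=; rewrite mem_enum.
  by rewrite -fsbig_seq ?enum_uniq // big_enum sumr_const mule_natl.
- by move=> x y _ _ [a [/set1P <- /set1P <-]].
- by move=> x _; apply: residue_set_measurable.
Qed.

Lemma card_rV_Fp : #|{: 'rV['F_l]_t}| = (l ^ t)%N.
Proof. by rewrite card_mx mul1n card_Fp. Qed.

(** The whole space has measure 1 and consists of l^t fibers of equal measure, which gives the
    measure of one. *)
Lemma haar_residue_set S : tau (residue_set S) = (#|S|%:R / l%:R ^+ t)%:E.
Proof.
have lt0 : l%:R ^+ t != 0 :> R by rewrite expf_neq0 // pnatr_eq0 -lt0n prime_gt0.
have := haar_residue_setM finset.setT.
have -> : residue_set finset.setT = setT.
  by apply/seteqP; split=> a //= _; rewrite /residue_set /= inE.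
rewrite probability_setT cardsT card_rV_Fp (haar_residue_setM S).
have /fineK <- : tau (residue_set [set 0]) \is a fin_num.
  by apply: fin_num_measure; apply: residue_set_measurable.
rewrite -!EFinM natrX => -[lm]; congr ((_ * _)%:E).
by apply: (mulfI lt0); rewrite -lm mulfV.
Qed.

End Haar.

(** * The event and its probability *)

Section Event.
Variables (l p q e g : nat).
Hypotheses (l_pr : prime l) (l_odd : odd l) (e_gt0 : (0 < e)%N).
Local Notation t := (p + e.-1 + g + q)%N.
Local Notation r := ((e + g)%:R : 'F_l).

Definition sign_row : 'rV['F_l]_t := \row_k (edge_sign p e g k)%:~R.

Definition leading_form (x : 'rV['F_l]_t) : 'F_l :=
  r * (\sum_k x 0 k ^+ 2) - (\sum_k sign_row 0 k * x 0 k) ^+ 2.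

Lemma sign_row_sqr : r = 1 + \sum_k sign_row 0 k ^+ 2.
Proof.
have /(congr1 (intr : int -> 'F_l)) := sum_edge_sign_sqr p q g e_gt0.
rewrite rmorph_nat => <-; rewrite rmorphD rmorph1 rmorph_sum; congr (_ + _).
by apply: eq_bigr => k _; rewrite mxE rmorphXn.
Qed.

Lemma event_residue :
  [set a : 'rV[padic_int l]_t | [/\ admissible a,
    mu_of p q e g a = 0%N & lambda_of p q e g a = 1]]%classic =
  residue_set [set x | leading_form x != 0].
Proof.
apply/seteqP.
have coefE (a : 'rV[padic_int l]_t) :
    residue (pscoef (char_series (voltage_of p q e g a)) 2) =
    - leading_form (residue_rV a).
  have [_ _ ->] := char_series_voltage_of l_pr l_odd e_gt0 a.
  rewrite rmorphB rmorphXn rmorphM rmorph_nat !rmorph_sum /leading_form opprB.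
  congr (_ ^+ 2 - _ * _); apply: eq_bigr => k _.
    by rewrite !mxE rmorphMz mulrzl.
  by rewrite rmorphXn mxE.
have P (a : 'rV[padic_int l]_t) :
    (mu_of p q e g a = 0%N /\ lambda_of p q e g a = 1) <->
    leading_form (residue_rV a) != 0.
  have [f0 f1 _] := char_series_voltage_of l_pr l_odd e_gt0 a.
  by rewrite -[leading_form _]opprK oppr_eq0 -coefE; apply: mu0_lambda1P.
split=> a; rewrite /residue_set /= inE.
  by move=> [_ mu0 la1]; apply/P.
move=> Qa; have [mu0 la1] := (P a).2 Qa; split=> // al.
(* A vector that is not admissible reduces to 0, where the form vanishes. *)
have a0 : residue_rV a = 0 by apply/rowP => k; rewrite !mxE; apply/residue_eq0/al.
case/eqP: Qa; rewrite a0 /leading_form big1 => [|k _]; last by rewrite mxE expr0n.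
by rewrite big1 => [|k _]; rewrite ?mxE ?mulr0 // expr0n subr0.
Qed.

Lemma zeros_leading_form :
  exists2 eta : int, eta = 1 \/ eta = -1 &
  l%:R * #|[set x | leading_form x == 0]|%:R =
  l%:R ^+ t + if (l %| e + g)%N || odd t then 0
              else eta * l%:R ^+ t./2 * (l%:R - 1) :> int.
Proof.
have F2 : 2%:R != 0 :> 'F_l by have := residue2_neq0 l_pr l_odd; rewrite rmorph_nat.
have cardE : (#|[set x | leading_form x == 0]|%:R : int) =
    (\sum_x (leading_form x == 0)%:R)%R.
  by rewrite -sum1_card natr_sum big_mkcond; apply: eq_bigr => x _; rewrite inE; case: eqP.
have lE : (l%:R : int) = #|'F_l|%:R by rewrite card_Fp.
rewrite cardE lE (dvdn_pcharf (pchar_Fp l_pr)).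
have [r0|r0] /= := eqVneq r 0; last first.
  by have [eta eta1 coneE] := card_cone F2 r0 sign_row_sqr; exists eta.
exists 1; first by left.
(* For r = 0 the form is -(v . x)^2, with zeros the hyperplane v . x = 0. *)
rewrite addr0 -(@card_hyperplane _ _ sign_row).
  congr (_ * _); apply: eq_bigr => x _.
  by rewrite /leading_form r0 mul0r sub0r oppr_eq0 sqrf_eq0.
(* If v were 0, then r = 1 + v . v would be 1 and not 0. *)
apply: contraPneq sign_row_sqr => ->; rewrite r0 big1 => [|k _]; last by rewrite mxE expr0n.
by move/eqP; rewrite addr0 eq_sym oner_eq0.
Qed.

Lemma Prob_mu0_lambda1E (R : realType) (tau : probability (padic_space l t) R) :
  normalized_haar tau -> (0 < t)%N ->
  exists2 eta : R, eta = 1 \/ eta = -1 &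
  Prob_mu0_lambda1 p q e g tau = 1 - (1 - l%:R ^- t)^-1 *
    (l%:R^-1 + (if (l %| e + g)%N || odd t then 0
                else eta * (l%:R - 1) * l%:R ^- (t %/ 2 + 1)) - l%:R ^- t).
Proof.
move=> tau_haar t_gt0.
have [eta eta1 /(congr1 (intr : int -> R))] := zeros_leading_form.
set N := #|_| => NE; exists eta%:~R.
  by case: eta1 => ->; [left|right]; rewrite ?rmorphN rmorph1.
have l0 : l%:R != 0 :> R by rewrite pnatr_eq0 -lt0n prime_gt0.
have cardE : #|[set x | leading_form x != 0]|%:R = l%:R ^+ t - N%:R :> R.
  rewrite -natrX -(card_rV_Fp t l_pr) -(cardC [set x | leading_form x == 0]) natrD.
  rewrite [X in X - _]addrC addrK; congr _%:R; apply: eq_card => x; rewrite !inE //.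
rewrite /Prob_mu0_lambda1 event_residue haar_residue_set // cardE /=.
have lt0 : l%:R ^+ t != 0 :> R by rewrite expf_neq0.
have d0 : 1 - l%:R ^- t != 0 :> R.
  rewrite subr_eq0 eq_sym invr_eq1 -natrX pnatr_eq1 -[1%N](expn0 l).
  by rewrite eqn_exp2l ?prime_gt1 // -lt0n.
(* Writing 1 as (1 - l^-t)^-1 (1 - l^-t) leaves an identity for 1 - N / l^t. *)
rewrite -[X in _ = X - _](mulVf d0) -mulrBr; congr (_ * _).
have -> : N%:R = (l%:R ^+ t + (if (l %| e + g)%N || odd t then 0
    else eta%:~R * l%:R ^+ t./2 * (l%:R - 1))) / l%:R :> R.
  apply: (canRL (mulfK l0)); move: NE; rewrite mulrC rmorphM !rmorph_nat => ->.
  rewrite rmorphD rmorphXn rmorph_nat; case: ifP => _; rewrite ?rmorph0 //.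
  by rewrite !rmorphM rmorphXn rmorphB !rmorph_nat rmorph1.
case: ifP => [_|/norP[_ t_even]]; first by field; rewrite lt0 l0.
(* For even t, this turns l^(t/2) / l^(t + 1) into l^-(t/2 + 1). *)
have lE : l%:R ^+ t = l%:R ^+ t./2 * l%:R ^+ t./2 :> R.
  by rewrite -exprD addnn -[in LHS](odd_double_half t) (negbTE t_even).
rewrite divn2 addn1 exprS; move: lt0; rewrite lE mulf_eq0 orbb => lt0.
by field; rewrite lt0 l0.
Qed.

End Event.

Theorem theorem5p3 (R : realType) (l : nat) (p q e g r t : nat)
    (tau : probability (padic_space l t) R) :
  prime l -> odd l ->
  (1 <= e)%N -> (1 <= r)%N -> (e + g = r)%N ->
  t = (p + q + r - 1)%N -> (2 <= t)%N ->
  normalized_haar tau ->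
  ((l %| r)%N ->
     Prob_mu0_lambda1 p q e g tau
       = 1 - (1 - l%:R ^- t)^-1 * (l%:R^-1 - l%:R ^- t)) /\
  (~~ (l %| r)%N ->
     exists upsilon : R, (upsilon = 1 \/ upsilon = - 1) /\
       Prob_mu0_lambda1 p q e g tau
         = if odd t then
             1 - (1 - l%:R ^- t)^-1 * (l%:R^-1 - l%:R ^- t)
           else
             1 - (1 - l%:R ^- t)^-1 *
               (l%:R^-1 + upsilon * (l%:R - 1) * l%:R ^- (t %/ 2 + 1) - l%:R ^- t)).
Proof.
move=> l_pr l_odd e_gt0 _ rE tE t_ge2 tau_haar; subst r.
(* The type of [tau] depends on t, so t itself is replaced by the sum of the block lengths. *)
have {}tE : t = (p + e.-1 + g + q)%N by lia.
subst t.
have [eta eta1 ->] := Prob_mu0_lambda1E l_pr l_odd e_gt0 tau_haar (ltnW t_ge2).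
split=> [->|/negbTE->] /=; first by rewrite addr0.
by exists eta; split=> //; case: ifP; rewrite ?addr0.
Qed.
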